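(* For all $n\geq 1$, $$\sum_{n\text{-partitions }\pi}\omega^c_\pi\,t^{\pi_{1\cdots1}}\,q^{|\pi|}=e^{t(M_{n-1}(q)-1)},$$ where $t$ is a formal variable.
   Context: For $n\geq 1$, an $n$-partition is a family $\pi=\{\pi_{i_1\ldots i_n}\}_{i_1,\ldots,i_n\geq 1}$ of non-negative integers with $\pi_{i_1\ldots i_n}\geq\pi_{j_1\ldots j_n}$ whenever $i_a\leq j_a$ for all $a$, and with finite size $|\pi|:=\sum\pi_{i_1\ldots i_n}<\infty$. A $0$-partition is a single non-negative integer, whose size is itself. For $n\geq 1$ put $M_n(q):=\sum_{n\text{-partitions }\pi}q^{|\pi|}$, and $M_0(q):=\frac{1}{1-q}$. Binary representation: for an $(n-1)$-partition $\xi=\{\xi_{i_1\ldots i_{n-1}}\}$, set $\xi(i_1,\ldots,i_{n-1},i_n):=1$ if $i_n\leq\xi_{i_1\ldots i_{n-1}}$ and $:=0$ otherwise, for $i_1,\ldots,i_n\geq 1$ (for $n=1$ and a $0$-partition $\xi\in\mathbb{Z}_{\geq0}$: $\xi(i_1)=1$ if $i_1\leq\xi$, else $0$). Combinatorial weight: for an $n$-partition $\pi$ ($n\geq 1$), let $\mathcal{C}_\pi$ be the (finite) set of families $\{m_\xi\}_\xi$ of non-negative integers, indexed by all non-empty (i.e. of positive size) $(n-1)$-partitions $\xi$, such that $\pi_{i_1\ldots i_n}=\sum_\xi m_\xi\cdot\xi(i_1,\ldots,i_n)$ for all $i_1,\ldots,i_n\geq 1$. Then $$\omega^c_\pi:=\sum_{\{m_\xi\}_\xi\in\mathcal{C}_\pi}\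 \prod_\xi\frac{1}{(m_\xi)!}.$$ *)

(* Defs.v *)
From HB Require Import structures.
From mathcomp Require Import all_boot all_order all_algebra.
From mathcomp Require Import finmap boolp classical_sets functions cardinality fsbigop.

Set Implicit Arguments.
Unset Strict Implicit.
Unset Printing Implicit Defensive.

Import GRing.Theory.
Local Open Scope classical_set_scope.
Local Open Scope ring_scope.

Record fps (R : Type) := Fps { coefs : nat -> R }.

Section FpsRing.
Variable R : comNzRingType.
Implicit Types f g h : fps R.

Lemma fpsP f g : coefs f =1 coefs g -> f = g.
Proof. by case: f g => [f] [g] /= /funext ->. Qed.

HB.instance Definition _ := gen_eqMixin (fps R).
HB.instance Definition _ := gen_choiceMixin (fps R).

Definition fpsC (c : R) : fps R := Fps (fun n => if n is 0%N then c else 0).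
Definition fpsX : fps R := Fps (fun n => (n == 1%N)%:R).
Definition fps_add f g := Fps (fun n => coefs f n + coefs g n).
Definition fps_opp f := Fps (fun n => - coefs f n).
Definition fps_mul f g :=
  Fps (fun n => \sum_(i < n.+1) coefs f i * coefs g (n - i)%N).

Lemma fps_addA : associative fps_add.
Proof. by move=> f g h; apply: fpsP => n /=; rewrite addrA. Qed.
Lemma fps_addC : commutative fps_add.
Proof. by move=> f g; apply: fpsP => n /=; rewrite addrC. Qed.
Lemma fps_add0 : left_id (fpsC 0) fps_add.
Proof. by move=> f; apply: fpsP => -[|n] /=; rewrite add0r. Qed.
Lemma fps_addN : left_inverse (fpsC 0) fps_opp fps_add.
Proof. by move=> f; apply: fpsP => -[|n] /=; rewrite addNr. Qed.

HB.instance Definition _ :=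
  GRing.isZmodule.Build (fps R) fps_addA fps_addC fps_add0 fps_addN.

Let tr N f : {poly R} := \poly_(i < N) coefs f i.

Let coef_mul N f g n : (n < N)%N ->
  coefs (fps_mul f g) n = (tr N f * tr N g)`_n.
Proof.
move=> nN; rewrite coefM; apply: eq_bigr => -[i ilen] _ /=.
by rewrite !coef_poly (leq_ltn_trans (leq_subr _ _) nN) (leq_ltn_trans _ nN).
Qed.

Lemma fps_mulA : associative fps_mul.
Proof.
move=> f g h; apply: fpsP => n.
have tr_le i (F : fps R) : (i < n.+1)%N -> coefs F i = (tr n.+1 F)`_i.
  by move=> lein; rewrite coef_poly lein.
transitivity (tr n.+1 f * (tr n.+1 g * tr n.+1 h))`_n.
  rewrite coefM; apply: eq_bigr => -[i lein] _ /=.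
  by rewrite -coef_mul ?ltnS ?leq_subr // -tr_le.
rewrite mulrA coefM; apply: eq_bigr => -[i lein] _ /=.
by rewrite -coef_mul // -tr_le ?ltnS ?leq_subr.
Qed.

Lemma fps_mulC : commutative fps_mul.
Proof.
by move=> f g; apply: fpsP => n; rewrite !(@coef_mul n.+1) // mulrC.
Qed.

Lemma fps_mul1 : left_id (fpsC 1) fps_mul.
Proof.
move=> f; apply: fpsP => n /=; rewrite big_ord_recl /= mul1r subn0.
by rewrite big1 ?addr0 // => i _; rewrite mul0r.
Qed.

Lemma fps_mulDl : left_distributive fps_mul fps_add.
Proof.
move=> f g h; apply: fpsP => n /=; rewrite -big_split /=.
by apply: eq_bigr => i _; rewrite mulrDl.
Qed.

Lemma fps_1neq0 : fpsC 1 != fpsC 0.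
Proof. by apply/eqP => /(congr1 (fun f : fps R => coefs f 0%N)) /= /eqP; rewrite oner_eq0. Qed.

HB.instance Definition _ := GRing.Zmodule_isComNzRing.Build (fps R)
  fps_mulA fps_mulC fps_mul1 fps_mulDl fps_1neq0.

Lemma coefsD f g n : coefs (f + g) n = coefs f n + coefs g n.
Proof. by []. Qed.

Lemma coefsM f g n :
  coefs (f * g) n = \sum_(i < n.+1) coefs f i * coefs g (n - i)%N.
Proof. by []. Qed.

Lemma coefs1 n : coefs (1 : fps R) n = (n == 0%N)%:R.
Proof. by case: n. Qed.

Lemma coefsCM c f n : coefs (fpsC c * f) n = c * coefs f n.
Proof.
rewrite coefsM big_ord_recl subn0 big1 ?addr0 // => i _.
by rewrite mul0r.
Qed.

Lemma coefsXM f n :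
  coefs (fpsX * f) n = if n is m.+1 then coefs f m else 0.
Proof.
rewrite coefsM; case: n => [|n].
  by rewrite big_ord_recl big_ord0 mul0r addr0.
rewrite 2!big_ord_recl big1 ?addr0 => [|i _]; last by rewrite mul0r.
by rewrite mul0r add0r mul1r /= subSS subn0.
Qed.

End FpsRing.

Arguments fpsX {R}.

Definition tqseries := fps (fps rat).

(* coefficient of t^a q^b *)
Definition coeftq (F : tqseries) (a b : nat) : rat := coefs (coefs F a) b.

Definition vart : tqseries := fpsX.
Definition varq : tqseries := fpsC fpsX.
Definition ratc (c : rat) : tqseries := fpsC (fpsC c).

(* The sum of a family of series each of whose coefficients vanishes for all
   but finitely many members; a coefficient at which the family has infinite
   support is set to 0. *)
Definition sumtq (I : choiceType) (F : I -> tqseries) : tqseries :=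
  Fps (fun a => Fps (fun b => \sum_(i \in [set: I]) coeftq (F i) a b)).

(* e^F, for F without constant term *)
Definition exptq (F : tqseries) : tqseries :=
  sumtq (fun k : nat => ratc (k`!%:R^-1) * F ^+ k).

(* Indices start from 0, so that i_a here stands for i_a + 1 in the usual
   1-based convention. For n = 0 there is a single (empty) index, and both
   conditions are void: a 0-partition is just a natural number. A family of
   natural numbers has finite sum iff it has finite support. *)
Record npartition (n : nat) := NPartition {
  part :> n.-tuple nat -> nat;
  part_decr : forall i j : n.-tuple nat,
    (forall a : 'I_n, (tnth i a <= tnth j a)%N) -> (part j <= part i)%N;
  part_fin : finite_set [set i | part i <> 0%N] }.

HB.instance Definition _ n := gen_eqMixin (npartition n).
HB.instance Definition _ n := gen_choiceMixin (npartition n).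

Definition psize n (p : npartition n) : nat :=
  \big[addn/0%N]_(i \in [set: n.-tuple nat]) p i.

Lemma psize0 (p : npartition 0) : psize p = p [tuple].
Proof.
rewrite /psize (fsbigTE [fset [tuple]]%fset).
  by rewrite big_seq_fset1.
by move=> i; rewrite (tuple0 i) inE eqxx.
Qed.

Definition corner n (p : npartition n) : nat := p (nseq_tuple n 0%N).

Definition nepartition (n : nat) := {x : npartition n | (0 < psize x)%N}.

(* x(i_1, ..., i_n, j) ; the 1-based condition j <= x_i reads j < x_i here *)
Definition binrep n (x : npartition n) (i : n.-tuple nat) (j : nat) : nat :=
  (j < x i)%N.

(* The finiteness clause says that the sum on the right-hand side converges. *)
Definition decompositions n (p : npartition n.+1) : set (nepartition n -> nat) :=
  [set m | forall (i : n.-tuple nat) (j : nat),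
    finite_set [set x | (m x * binrep (val x) i j)%N <> 0%N] /\
    p (rcons_tuple i j) =
      \big[addn/0%N]_(x \in [set: nepartition n]) (m x * binrep (val x) i j)%N].

Definition comb_weight n (p : npartition n.+1) : rat :=
  \sum_(m \in decompositions p)
    \big[*%R/1]_(x \in [set: nepartition n]) ((m x)`!%:R^-1 : rat).

Definition geomq : tqseries := sumtq (fun k : nat => varq ^+ k).

Lemma coeftq_varqX k a b : coeftq (varq ^+ k) a b = ((a == 0) && (b == k))%N%:R.
Proof.
elim: k b => [|k IHk] b; first by rewrite expr0; case: a b => [|a] [|b].
rewrite exprS /coeftq coefsCM coefsXM.
by case: b => [|b]; [rewrite andbF | rewrite [LHS]IHk eqSS].
Qed.

Lemma geomqE : (1 - varq) * geomq = 1.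
Proof.
have coef_geomq a b : coefs (coefs geomq a) b = (a == 0%N)%:R.
  rewrite /= (fsbigTE [fset b]%fset) ?big_seq_fset1.
    by rewrite coeftq_varqX eqxx andbT.
  by move=> k; rewrite inE coeftq_varqX eq_sym => /negPf ->; rewrite andbF.
suff E : geomq = 1 + varq * geomq by rewrite mulrBl mul1r {1}E addrK.
apply: fpsP => a; apply: fpsP => b.
rewrite coef_geomq; rewrite !coefsD coefsCM coefsXM coefs1.
by case: a b => [|a] [|b]; rewrite ?coef_geomq ?addr0 ?add0r.
Qed.

(* M_n(q) *)
Definition partgf (n : nat) : tqseries :=
  if n is 0%N then geomq else sumtq (fun p : npartition n => varq ^+ psize p).

(* Main.v *)
Require Import Defs.
From mathcomp Require Import all_boot all_order all_algebra.
From mathcomp Require Import finmap boolp classical_sets functions.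
From mathcomp Require Import cardinality fsbigop.

(** The binary function of an n-partition is the indicator function of a finite
order ideal in n+1 coordinates, and every such ideal arises this way. So a
decomposition writes an (n+1)-partition as a sum of such indicator functions,
the ideal of [x] being taken [m x] times. Two facts make this a generating
function identity.

- Every finitely supported [m] decomposes exactly one partition
  ([decomposition_partition_ex], [decomposition_partition_uniq]), and a
  decomposition is always finitely supported ([decomposition_fin]). So summing
  the weights of all partitions amounts to summing the products of the
  [1 / (m x)!] over all finitely supported [m].
- Under this correspondence both statistics become linear in [m]: the binary
  function of a non-empty partition takes the value 1 at the corner and has
  total mass equal to the size of that partition. Hence the corner is the sum
  of the [m x] and the size is the sum of the [m x * |x|]
  ([decomposition_corner], [decomposition_psize]).

The coefficient of [t^a q^b] on the left is therefore the sum of the products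
of the [1 / (m x)!] over the [m] of total multiplicity [a] and total size [b].
By the multinomial theorem this is the coefficient of [q^b] in the a-th
divided power of the sum of the [q^|x|] over the non-empty [x]
([divpow_multinomial]). That sum is [M_n(q) - 1] ([partgf_sub1]), and the a-th
divided power of [M_n(q) - 1] is the coefficient of [t^a] on the right
([coeftq_exptq]).

To stay within finite sums, [a] and [b] are fixed from the start: only the
non-empty partitions of size at most [b] can occur, there are finitely many of
them ([finite_psize_le]), and each occurs at most [a] times, so the relevant
[m] form a finite type. *)

Set Implicit Arguments.
Unset Strict Implicit.
Unset Printing Implicit Defensive.

Import GRing.Theory Num.Theory.
Local Open Scope classical_set_scope.
Local Open Scope ring_scope.

(** * Sums with finite support *)

Section FiniteSupportSums.
Variables (R : Type) (idx : R) (op : Monoid.com_law idx).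

(** The index types may be infinite: it is the support of the double family
that has to lie in a finite rectangle. *)
Lemma exchange_fsbigT (I J : choiceType) (A : set I) (B : set J)
    (F : I -> J -> R) :
    finite_set A -> finite_set B ->
    (forall i j, F i j <> idx -> A i /\ B j) ->
  \big[op/idx]_(i \in [set: I]) \big[op/idx]_(j \in [set: J]) F i j =
  \big[op/idx]_(j \in [set: J]) \big[op/idx]_(i \in [set: I]) F i j.
Proof.
move=> finA finB suppF.
have outA i j : ~ A i -> F i j = idx.
  by move=> nA; apply: contrapT => /suppF[].
have outB i j : ~ B j -> F i j = idx.
  by move=> nB; apply: contrapT => /suppF[].
transitivity (\big[op/idx]_(i \in A) \big[op/idx]_(j \in B) F i j).
  rewrite -(fsbig_widen A setT) //= => [|i [_ nA]]; last first.
    by rewrite /= fsbig1 // => j _; apply: outA.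
  apply: eq_fsbigr => i _; rewrite -(fsbig_widen B setT) //= => j [_ nB].
  exact: outB.
rewrite exchange_fsbig //.
rewrite -[RHS](fsbig_widen B setT) //= => [|j [_ nB]]; last first.
  by rewrite /= fsbig1 // => i _; apply: outB.
apply: eq_fsbigr => j _; rewrite -[RHS](fsbig_widen A setT) //= => i [_ nA].
exact: outA.
Qed.

Lemma pair_fsbigT (I J : choiceType) (A : set (I * J)) (F : I -> J -> R) :
    finite_set A -> (forall i j, F i j <> idx -> A (i, j)) ->
  \big[op/idx]_(i \in [set: I]) \big[op/idx]_(j \in [set: J]) F i j =
  \big[op/idx]_(ij \in [set: I * J]) F ij.1 ij.2.
Proof.
move=> finA suppF.
have outF i j : ~ A (i, j) -> F i j = idx.
  by move=> nA; apply: contrapT => /suppF.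
pose A1 := fst @` A; pose A2 := snd @` A.
have finA1 : finite_set A1 by exact: finite_image.
have finA2 : finite_set A2 by exact: finite_image.
rewrite -(fsbig_widen A1 setT) //= => [|i [_ nA]]; last first.
  by rewrite /= fsbig1 // => j _; apply: outF => Aij; apply: nA; exists (i, j).
transitivity (\big[op/idx]_(i \in A1) \big[op/idx]_(j \in A2) F i j).
  apply: eq_fsbigr => i _; rewrite -[LHS](fsbig_widen A2 setT) //= => j [_ nA].
  by apply: outF => Aij; apply: nA; exists (i, j).
rewrite pair_fsbig //; apply: fsbig_widen => // -[i j] [_ nA] /=.
by apply: outF => Aij; apply: nA; split; exists (i, j).
Qed.

Lemma fsbig_finType (T : finType) (P : pred T) (F : T -> R) :
  \big[op/idx]_(x \in [set x | P x]) F x = \big[op/idx]_(x | P x) F x.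
Proof.
rewrite (@bigfs _ _ _ _ (index_enum T)) ?index_enum_uniq //.
by move=> i _; rewrite mem_index_enum.
Qed.

End FiniteSupportSums.

Lemma leq_sum_fsbig (I : choiceType) (f : I -> nat) (A : {fset I}) :
    finite_set [set i | f i <> 0%N] ->
  (\sum_(i <- A) f i <= \big[addn/0%N]_(i \in [set: I]) f i)%N.
Proof.
move=> finf; pose B := fset_set [set i | f i <> 0%N].
rewrite (fsbigTE (A `|` B)%fset); last first.
  move=> i; rewrite inE negb_or => /andP[_ iB]; apply: contrapT => fi.
  by move: iB; rewrite /B in_fset_set // mem_set.
rewrite (bigID (mem A)) /= [X in (_ <= X + _)%N]big_fset_condE.
suff -> : [fset i in A `|` B | i \in A]%fset = A by rewrite leq_addr.
by apply/fsetP => i; rewrite !inE /=; case: (i \in A); rewrite ?andbF.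
Qed.

Lemma leq_fsbig (I : choiceType) (f : I -> nat) i :
    finite_set [set i | f i <> 0%N] ->
  (f i <= \big[addn/0%N]_(i \in [set: I]) f i)%N.
Proof. by move/(leq_sum_fsbig [fset i]%fset); rewrite big_seq_fset1. Qed.

(** * Divided powers and the multinomial theorem *)

Section Multinomial.

Variables (F : numFieldType) (R : comAlgType F) (T : finType).

(** The coefficients of the exponential series; unlike plain powers they satisfy
an addition formula without binomial coefficients, [divpowD]. *)
Definition divpow k (y : R) : R := k`!%:R^-1 *: y ^+ k.

Lemma divpowD k (y z : R) :
  divpow k (y + z) = \sum_(i < k.+1) divpow i y * divpow (k - i) z.
Proof.
rewrite /divpow addrC exprDn scaler_sumr; apply: eq_bigr => -[i /= ik] _.
rewrite mulrC -scalerAl -scalerAr scalerA -scaler_nat scalerA; congr (_ *: _).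
rewrite -(bin_fact (ltnSE ik)) !natrM invfM mulrAC mulVf ?mul1r ?invfM //.
by rewrite pnatr_eq0 -lt0n bin_gt0 -ltnS.
Qed.

(** The addition formula says that divided powers of a sum are the coefficients
of a product of exponential series, here truncated after degree [k]. *)
Lemma divpow_sum k (r : seq T) (y : T -> R) :
  divpow k (\sum_(x <- r) y x) =
  (\prod_(x <- r) \poly_(i < k.+1) divpow i (y x))`_k.
Proof.
have: (k < k.+1)%N by [].
(* The truncation order stays fixed, the extracted degree varies. *)
move: {1 3 5}k; elim: r => [|x r IHr] j jk.
  rewrite !big_nil coef1 /divpow; case: j jk => [|j] _.
    by rewrite expr0 fact0 invr1 scale1r.
  by rewrite expr0n scaler0.
rewrite !big_cons divpowD coefM; apply: eq_bigr => -[i /= ij] _.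
by rewrite coef_poly (leq_trans ij jk) IHr // (leq_ltn_trans (leq_subr _ _) jk).
Qed.

(** Expanding the product of truncated exponential series given by [divpow_sum]
distributes a degree [m x] to each [x], and only the total degree [k]
contributes. *)
Lemma divpow_multinomial k (y : T -> R) :
  divpow k (\sum_x y x) =
  \sum_(m : {ffun T -> 'I_k.+1} | (\sum_x m x == k)%N)
    (\prod_x (m x)`!%:R^-1) *: \prod_x y x ^+ m x.
Proof.
rewrite divpow_sum; under eq_bigr do rewrite poly_def.
rewrite bigA_distr_bigA coef_sum [RHS]big_mkcond; apply: eq_bigr => m _.
under eq_bigr do rewrite -mul_polyC.
rewrite big_split /= prodrXr -rmorph_prod /= coefCM coefXn.
rewrite eq_sym; case: eqP => _; last by rewrite mulr0.
by rewrite mulr1 /divpow -scaler_prod.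
Qed.

End Multinomial.

(** * Formal power series *)

Section Series.

Variable R : comNzRingType.

Lemma fpsC_exp (c : R) k : fpsC c ^+ k = fpsC (c ^+ k).
Proof.
elim: k => [|k IHk]; first by rewrite !expr0.
rewrite !exprS IHk; apply: fpsP => n; rewrite coefsCM.
by case: n => [|n] //=; rewrite mulr0.
Qed.

Lemma coefs_fpsX_exp k n : coefs (fpsX ^+ k : fps R) n = (n == k)%:R.
Proof.
elim: k n => [|k IHk] n; first by rewrite expr0 coefs1.
by rewrite exprS coefsXM; case: n.
Qed.

(** The coefficients of a power up to order [b] only depend on those of the base
up to order [b]; this turns a power of an infinite sum into one of a finite
sum. *)
Lemma coefs_expr_poly (f : fps R) (P : {poly R}) b k c :
    (forall d, (d <= b)%N -> coefs f d = P`_d) -> (c <= b)%N ->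
  coefs (f ^+ k) c = (P ^+ k)`_c.
Proof.
move=> fP; elim: k c => [|k IHk] c cb; first by rewrite !expr0 coefs1 coef1.
rewrite !exprS coefsM coefM; apply: eq_bigr => -[i /= ic] _.
rewrite fP ?IHk //; first exact: leq_trans (leq_subr _ _) cb.
exact: leq_trans (ltnSE ic) cb.
Qed.

End Series.

Lemma coeftq_monomial w i j a b :
  coeftq (ratc w * vart ^+ i * varq ^+ j) a b = w * ((a == i) && (b == j))%:R.
Proof.
rewrite /coeftq /ratc /varq fpsC_exp -mulrA coefsCM mulrC [vart ^+ i * _]mulrC.
rewrite coefsCM coefs_fpsX_exp mulrC coefsCM; congr (_ * _).
by case: (a == i); [rewrite mulr1 coefs_fpsX_exp | rewrite mulr0; case: b].
Qed.

Lemma coeftq_exptq (g : fps rat) a b :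
  coeftq (exptq (vart * fpsC g)) a b = a`!%:R^-1 * coefs (g ^+ a) b.
Proof.
have coefk k : coeftq (ratc k`!%:R^-1 * (vart * fpsC g) ^+ k) a b =
    if a == k then k`!%:R^-1 * coefs (g ^+ k) b else 0.
  rewrite /coeftq /ratc !coefsCM exprMn fpsC_exp [vart ^+ k * _]mulrC.
  rewrite coefsCM coefs_fpsX_exp.
  by case: (a == k); rewrite ?mulr1 // mulr0; case: b => [|b]; rewrite mulr0.
rewrite /coeftq /= (fsbigTE [fset a]%fset) ?big_seq_fset1 => [|k].
  by rewrite coefk eqxx.
by rewrite inE coefk eq_sym => /negPf ->.
Qed.

(** * Partitions and their sizes *)

Section Partitions.

Variable n : nat.
Implicit Types (p x : npartition n).

Lemma npartition_eq p x : p =1 x -> p = x.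
Proof.
case: p x => [p dp fp] [x dx fx] /= /funext E; subst x.
by rewrite (Prop_irrelevance dx dp) (Prop_irrelevance fx fp).
Qed.

Lemma part_leq_psize p i : (p i <= psize p)%N.
Proof. by apply: leq_fsbig; exact: part_fin. Qed.

Lemma part_leq_corner p i : (p i <= corner p)%N.
Proof. by apply: part_decr => k; rewrite tnth_nseq. Qed.

Lemma psize_eq0P p : reflect (p =1 fun=> 0%N) (psize p == 0%N).
Proof.
apply: (iffP eqP) => [p0 i|p0]; last by rewrite /psize fsbig1.
by apply/eqP; rewrite -leqn0 -p0 part_leq_psize.
Qed.

Lemma corner_gt0 p : (0 < psize p)%N -> (0 < corner p)%N.
Proof.
rewrite !lt0n; apply: contra => /eqP p0; apply/psize_eq0P => i.
by apply/eqP; rewrite -leqn0 -p0 part_leq_corner.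
Qed.

Lemma empty_decr (i j : n.-tuple nat) :
  (forall a : 'I_n, (tnth i a <= tnth j a)%N) -> (0 <= 0)%N.
Proof. by []. Qed.

Lemma empty_fin : finite_set [set i : n.-tuple nat | 0%N <> 0%N].
Proof. by rewrite (_ : [set _ | _] = set0) //; apply/seteqP; split. Qed.

Definition empty_partition := NPartition empty_decr empty_fin.

(** Lowering the k-th coordinate of an index in the support gives [tnth i k + 1]
indices of the support, each contributing at least 1 to the size. *)
Lemma index_lt_psize p i (k : 'I_n) : p i <> 0%N -> (tnth i k < psize p)%N.
Proof.
move=> pi; pose upd j := [tuple if l == k then j else tnth i l | l < n].
pose r := iota 0 (tnth i k).+1; pose A := [fset upd j | j in r]%fset.
have cardA : #|` A| = (tnth i k).+1.
  rewrite -[RHS](size_iota 0) -/r card_in_imfset /=; last first.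
    move=> j j' _ _ /(congr1 (fun t => tnth t k)).
    by rewrite !tnth_mktuple eqxx.
  by rewrite mem_iota undup_id ?iota_uniq.
rewrite -cardA -sum1_size; apply: leq_trans (leq_sum_fsbig A (part_fin p)).
rewrite big_seq [X in (_ <= X)%N]big_seq; apply: leq_sum => t.
case/imfsetP => j /=; rewrite mem_iota add0n ltnS => /andP[_ ji] ->.
have: (0 < p i)%N by rewrite lt0n; apply/eqP.
move/leq_trans; apply; apply: part_decr => l; rewrite tnth_mktuple.
by case: eqP => // ->.
Qed.

(** By [index_lt_psize] and [part_leq_psize], both the support and the values of
a partition of size at most [b] are bounded by [b], so it is determined by a
function between finite types. *)
Lemma finite_psize_le b : finite_set [set p : npartition n | (psize p <= b)%N].
Proof.
pose box p := [ffun i : n.-tuple 'I_b.+1 =>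
  inord (p [tuple of map val i]) : 'I_b.+1].
have box_inj : {in [set p : npartition n | (psize p <= b)%N] &, injective box}.
  move=> p x; rewrite !inE /= => pb xb E; apply: npartition_eq => i.
  have [ib|] := boolP [forall k, (tnth i k < b.+1)%N].
    pose i' : n.-tuple 'I_b.+1 := [tuple inord (tnth i k) | k < n].
    have i'E : [tuple of map val i'] = i.
      apply: eq_from_tnth => k; rewrite tnth_map tnth_mktuple /=.
      by rewrite inordK // (forallP ib).
    move: (congr1 (fun f : {ffun n.-tuple 'I_b.+1 -> 'I_b.+1} => val (f i')) E).
    rewrite !ffunE i'E /= !inordK //; rewrite ltnS.
      exact: leq_trans (part_leq_psize x i) xb.
    exact: leq_trans (part_leq_psize p i) pb.
  rewrite negb_forall => /existsP[k]; rewrite -leqNgt => bk.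
  have out (q : npartition n) : (psize q <= b)%N -> q i = 0%N.
    move=> qb; apply: contrapT => /(@index_lt_psize q i k).
    by rewrite ltnNge (leq_trans qb) // ltnW.
  by rewrite !out.
by rewrite -(eq_finite_set (inj_card_eq box_inj)).
Qed.

End Partitions.

(** * Decompositions into binary representations *)

Section BinaryRepresentation.

Variable n : nat.
Implicit Types (x : npartition n) (p : npartition n.+1).

Definition tinit (t : n.+1.-tuple nat) : n.-tuple nat :=
  [tuple tnth t (widen_ord (leqnSn n) k) | k < n].
Definition tlast (t : n.+1.-tuple nat) : nat := tnth t ord_max.

Lemma tinit_rcons i j : tinit (rcons_tuple i j) = i.
Proof.
apply: eq_from_tnth => k; rewrite tnth_mktuple !(tnth_nth 0%N) /=.
by rewrite nth_rcons size_tuple ltn_ord.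
Qed.

Lemma tlast_rcons i j : tlast (rcons_tuple i j) = j.
Proof. by rewrite /tlast (tnth_nth 0%N) /= nth_rcons size_tuple ltnn eqxx. Qed.

Lemma rcons_tinit t : rcons_tuple (tinit t) (tlast t) = t.
Proof.
apply: eq_from_tnth => k.
rewrite (tnth_nth 0%N) nth_rcons (size_tuple (tinit t)).
case: (ltngtP k n) (ltnSE (ltn_ord k)) => [kn|//|kn] _.
  rewrite -(tnth_nth _ _ (Ordinal kn)) tnth_mktuple.
  by congr (tnth _ _); apply: val_inj.
by rewrite /tlast; congr (tnth _ _); apply: val_inj.
Qed.

Lemma finite_binrep x :
  finite_set [set ij : n.-tuple nat * nat | binrep x ij.1 ij.2 <> 0%N].
Proof.
apply: (@sub_finite_set _ _ ([set i | x i <> 0%N] `*` `I_(psize x))).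
  case=> i j; rewrite /binrep /=; case: ltnP => //= ji _.
  split; last exact: leq_trans ji (part_leq_psize x i).
  by move=> xi; rewrite xi in ji.
by apply: finite_setX; [exact: part_fin | exact: finite_II].
Qed.

(** At a given [i] the binary function is 1 for exactly [x i] values of the last
index. *)
Lemma sum_binrep x :
  \big[addn/0%N]_(ij \in [set: n.-tuple nat * nat]) binrep x ij.1 ij.2 =
  psize x.
Proof.
rewrite -(pair_fsbigT _ (finite_binrep x)) //; apply: eq_fsbigr => i _.
rewrite -(fsbig_widen `I_(x i) setT) //=; last first.
  by move=> j [_ /negP]; rewrite /binrep /= => /negPf ->.
rewrite -fsbig_ord (eq_bigr (fun=> 1%N)) => [|j _].
  by rewrite sum1_card card_ord.
by rewrite /binrep ltn_ord.
Qed.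

Lemma psize_rcons p :
  psize p = \big[addn/0%N]_(ij \in [set: n.-tuple nat * nat])
    p (rcons_tuple ij.1 ij.2).
Proof.
apply: (reindex_fsbigT (fun ij : n.-tuple nat * nat => rcons_tuple ij.1 ij.2)).
exists (fun t => (tinit t, tlast t)) => [[i j]|t] /=.
  by rewrite tinit_rcons tlast_rcons.
exact: rcons_tinit.
Qed.

Lemma binrep_corner (x : nepartition n) :
  binrep (val x) (nseq_tuple n 0%N) 0 = 1%N.
Proof. by rewrite /binrep corner_gt0 //; exact: (valP x). Qed.

Lemma corner_rcons p : corner p = p (rcons_tuple (nseq_tuple n 0%N) 0%N).
Proof.
congr (part p _); apply: eq_from_tnth => k; rewrite tnth_nseq.
by rewrite (tnth_nth 0%N) /= nth_rcons nth_nseq !if_same.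
Qed.

Section Decomposition.

Variables (p : npartition n.+1) (m : nepartition n -> nat).
Hypothesis pm : decompositions p m.

(** At the corner all the binary functions are 1, so convergence of the sum
there already forces finite support. *)
Lemma decomposition_fin : finite_set [set x | m x <> 0%N].
Proof.
have [+ _] := pm (nseq_tuple n 0%N) 0%N; apply: sub_finite_set => x /=.
by rewrite binrep_corner muln1.
Qed.

Lemma decomposition_corner :
  corner p = \big[addn/0%N]_(x \in [set: nepartition n]) m x.
Proof.
have [_] := pm (nseq_tuple n 0%N) 0%N; rewrite corner_rcons => ->.
by apply: eq_fsbigr => x _; rewrite binrep_corner muln1.
Qed.

Lemma decomposition_psize :
  psize p = \big[addn/0%N]_(x \in [set: nepartition n]) (m x * psize (val x))%N.
Proof.
pose A := [set ij : n.-tuple nat * nat | p (rcons_tuple ij.1 ij.2) <> 0%N].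
have finA : finite_set A.
  pose h (ij : n.-tuple nat * nat) := rcons_tuple ij.1 ij.2.
  apply: (@finite_preimage _ _ [set t | p t <> 0%N] h); last exact: part_fin.
  move=> [i j] [i' j'] _ _ /= E.
  rewrite -(tinit_rcons i j) -{2}(tlast_rcons i j).
  by rewrite -[rcons_tuple i j]/(h (i, j)) E tinit_rcons tlast_rcons.
rewrite psize_rcons.
under eq_fsbigr do rewrite (pm _ _).2.
rewrite (exchange_fsbigT _ finA decomposition_fin) /=; last first.
  (* A term is at most [p (i, j)], so the support in [(i, j)] is that of [p]. *)
  move=> [i j] x /= mx; split; last by move=> m0; rewrite m0 in mx.
  rewrite /A /= (pm i j).2 => p0; apply: mx.
  by move: (leq_fsbig x (pm i j).1); rewrite p0 leqn0 => /eqP.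
apply: eq_fsbigr => x _; rewrite -sum_binrep full_fsbig_distrr // setTI.
exact: finite_binrep.
Qed.

End Decomposition.

Lemma decomposition_partition_uniq p p' (m : nepartition n -> nat) :
  decompositions p m -> decompositions p' m -> p = p'.
Proof.
move=> pm p'm; apply: npartition_eq => t; rewrite -(rcons_tinit t).
by rewrite (pm _ _).2 (p'm _ _).2.
Qed.

(** Binary functions are weakly decreasing with finite support, and finite sums
inherit both properties. *)
Lemma decomposition_partition_ex (m : nepartition n -> nat) :
  finite_set [set x | m x <> 0%N] -> exists p, decompositions p m.
Proof.
move=> finm; pose f t := \big[addn/0%N]_(x \in [set: nepartition n])
  (m x * binrep (val x) (tinit t) (tlast t))%N.
pose M := fset_set [set x | m x <> 0%N].
have fE t : f t = (\sum_(x <- M) m x * binrep (val x) (tinit t) (tlast t))%N.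
  apply: fsbigTE => x; rewrite /M in_fset_set // notin_setE /= => /contrapT ->.
  by rewrite mul0n.
have f_decr (i j : n.+1.-tuple nat) :
    (forall a : 'I_n.+1, (tnth i a <= tnth j a)%N) -> (f j <= f i)%N.
  move=> ij; rewrite !fE; apply: leq_sum => x _; rewrite leq_mul2l.
  apply/orP; right; rewrite /binrep.
  case: (ltnP (tlast j)) => // lj; rewrite (leq_ltn_trans (ij _)) //.
  apply: leq_trans lj _; apply: part_decr => k; rewrite !tnth_mktuple.
  exact: ij.
have f_fin : finite_set [set t | f t <> 0%N].
  pose A (x : nepartition n) : set (n.+1.-tuple nat) :=
    [set rcons_tuple ij.1 ij.2 | ij in
      [set ij : n.-tuple nat * nat | binrep (val x) ij.1 ij.2 <> 0%N]].
  apply: (@sub_finite_set _ _ (\bigcup_(x in [set x | m x <> 0%N]) A x)).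
    move=> t /= /eqP; rewrite fE sum_nat_seq_neq0 => /hasP[x].
    rewrite /M in_fset_set // inE /= => mx; rewrite muln_eq0 negb_or.
    move=> /andP[_ /eqP bx]; exists x => //; exists (tinit t, tlast t) => //=.
    exact: rcons_tinit.
  apply: bigcup_finite => // x _; apply: finite_image; exact: finite_binrep.
exists (NPartition f_decr f_fin) => i j; split.
  apply: sub_finite_set finm => x /= mx m0; apply: mx.
  by rewrite m0.
by rewrite /= /f tinit_rcons tlast_rcons.
Qed.

End BinaryRepresentation.

(** * The generating function of non-empty partitions *)

(** A 0-partition is determined by its size, which can be any number, so the
geometric series is also a sum over partitions. *)
Lemma partgf_partitions n :
  partgf n = sumtq (fun p : npartition n => varq ^+ psize p).
Proof.
case: n => [|n] //; apply: fpsP => a; apply: fpsP => b.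
apply: (reindex_fsbigT (fun p : npartition 0 => psize p)).
have const_decr k (i j : 0.-tuple nat) :
  (forall a : 'I_0, (tnth i a <= tnth j a)%N) -> (k <= k)%N by [].
have const_fin k : finite_set [set i : 0.-tuple nat | k <> 0%N].
  apply: (@sub_finite_set _ _ [set [tuple]]) => [i _ /=|]; first exact: tuple0.
  exact: finite_set1.
exists (fun k => NPartition (const_decr k) (const_fin k)) => [p|k].
  by apply: npartition_eq => i; rewrite psize0 (tuple0 i).
by rewrite psize0.
Qed.

Definition nepartgf n : fps rat :=
  Fps (fun b => \sum_(x \in [set: nepartition n])
                  ((b == psize (val x))%:R : rat)).

(** The subtracted 1 is the contribution of the empty partition, the only one of
size 0. *)
Lemma partgf_sub1 n : partgf n - 1 = fpsC (nepartgf n).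
Proof.
apply/eqP; rewrite subr_eq; apply/eqP; rewrite partgf_partitions.
apply: fpsP => -[|a]; apply: fpsP => b; last first.
  rewrite !coefsD coefs1 /= fsbig1 ?add0r; first by case: b.
  by move=> p _; rewrite coeftq_varqX.
rewrite !coefsD coefs1.
transitivity (\sum_(p \in [set: npartition n]) ((b == psize p)%:R : rat)).
  by apply: eq_fsbigr => p _; rewrite coeftq_varqX.
case: b => [|b].
  rewrite (fsbigTE [fset empty_partition n]%fset) => [|p]; last first.
    rewrite inE => /eqP pN; rewrite eq_sym; case: (psize_eq0P p) => // p0.
    by case: pN; apply: npartition_eq => i; rewrite p0.
  rewrite big_seq_fset1 eq_sym; case: psize_eq0P => [_|[]//].
  by rewrite /= fsbig1 ?add0r // => x _; case: eqP (valP x) => //= <-.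
rewrite addr0.
rewrite -(fsbig_widen [set p : npartition n | (0 < psize p)%N] setT) //=.
  apply: (reindex_fsbig val); split=> [x _ /=|x y _ _|p /= pN].
  - exact: (valP x).
  - exact: val_inj.
  - by exists (exist _ p pN).
by move=> p [_ /= p0]; case: eqP p0 => // <-.
Qed.

(** * Bounded multiplicities and the coefficient of t^a q^b *)

Section MultiplicityFunctions.

Variables (n a b : nat).

Let X := nepartition n.

Lemma finite_small_parts : finite_set [set x : X | (psize (val x) <= b)%N].
Proof.
apply: (@finite_preimage _ _ [set p : npartition n | (psize p <= b)%N] val).
  by move=> x y _ _; apply: val_inj.
exact: finite_psize_le.
Qed.

Definition small_parts : {fset X} :=
  fset_set [set x : X | (psize (val x) <= b)%N].

Lemma in_small_parts (x : X) : (x \in small_parts) = (psize (val x) <= b)%N.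
Proof.
rewrite in_fset_set; last exact: finite_small_parts.
by apply/idP/idP; rewrite inE.
Qed.

(** The bound [a] on the values loses nothing when the total multiplicity is
[a], and makes this a finite type. *)
Definition multiplicities := {ffun small_parts -> 'I_a.+1}.

Definition extend0 (m : multiplicities) (x : X) : nat :=
  if insub x is Some u then m u else 0%N.

Lemma extend0E m (u : small_parts) : extend0 m (val u) = m u.
Proof. by rewrite /extend0 valK. Qed.

Lemma extend0_out m x : x \notin small_parts -> extend0 m x = 0%N.
Proof. by move=> xN; rewrite /extend0 insubN. Qed.

Lemma extend0_inj : injective extend0.
Proof.
move=> m m' E; apply/ffunP => u; apply: val_inj => /=.
by rewrite -!extend0E E.
Qed.

Lemma extend0_fin m : finite_set [set x | extend0 m x <> 0%N].
Proof.
apply: (@sub_finite_set _ _ [set` small_parts]) => [x /= mx|].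
  by apply: contrapT => /negP /(extend0_out m).
exact: finite_fset.
Qed.

(** Used for the corner, the size and the product of the inverse factorials,
whose terms are neutral where the multiplicity is 0. *)
Lemma extend0_big (R : Type) (idx : R) (op : Monoid.com_law idx)
    (F : X -> nat -> R) m :
    (forall x, F x 0%N = idx) ->
  \big[op/idx]_(x \in [set: X]) F x (extend0 m x) =
  \big[op/idx]_(u : small_parts) F (val u) (m u).
Proof.
move=> F0; rewrite (fsbigTE small_parts) => [|x xN]; last first.
  by rewrite extend0_out.
by rewrite big_seq_fsetE; apply: eq_bigr => u _; rewrite extend0E.
Qed.

Definition assemble (m : multiplicities) : npartition n.+1 :=
  projT1 (cid (decomposition_partition_ex (extend0_fin m))).

Lemma assembleP m : decompositions (assemble m) (extend0 m).
Proof. by rewrite /assemble; case: cid. Qed.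

Lemma assemble_corner m : corner (assemble m) = (\sum_u m u)%N.
Proof.
rewrite (decomposition_corner (assembleP m)).
by rewrite (extend0_big _ (F := fun _ k => k)).
Qed.

Lemma assemble_psize m :
  psize (assemble m) = (\sum_u m u * psize (val (val u)))%N.
Proof.
rewrite (decomposition_psize (assembleP m)).
by rewrite (extend0_big _ (F := fun x k => k * psize (val x))%N).
Qed.

(** In a decomposition of [p] each [m x] is at most the corner [a], and
[m x > 0] implies that the size of [x] is at most the size [b] of [p], so that
no decomposition is lost by the bounds. *)
Lemma decompositionsE p : corner p = a -> psize p = b ->
  decompositions p = extend0 @` [set m | assemble m == p].
Proof.
move=> pa pb; apply/seteqP; split=> [m pm|_ [m /= /eqP <- <-]]; last first.
  exact: assembleP.
have finm := decomposition_fin pm.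
have m_le x : (m x < a.+1)%N.
  by rewrite ltnS -pa (decomposition_corner pm) leq_fsbig.
pose m' : multiplicities := [ffun u => Ordinal (m_le (val u))].
have m'E : extend0 m' = m.
  apply/funext => x; have [xA|xN] := boolP (x \in small_parts).
    by rewrite -[x]/(val [` xA]%fset) extend0E ffunE.
  rewrite extend0_out //; apply/esym; move: xN; rewrite in_small_parts -ltnNge.
  case: (posnP (m x)) => // mx; rewrite ltnNge -pb (decomposition_psize pm).
  rewrite (leq_trans (leq_pmull _ mx)) //.
  apply: (leq_fsbig (f := fun x => m x * psize (val x))%N).
  by apply: sub_finite_set finm => y /= my m0; apply: my; rewrite m0.
exists m' => //=; apply/eqP.
apply: decomposition_partition_uniq (assembleP m') _.
by rewrite m'E.
Qed.

Definition weight (m : multiplicities) : rat := \prod_u ((m u)`!%:R^-1).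

Lemma comb_weightE p : corner p = a -> psize p = b ->
  comb_weight p = \sum_(m | assemble m == p) weight m.
Proof.
move=> pa pb; rewrite /comb_weight (decompositionsE pa pb) fsbig_image.
  rewrite fsbig_finType; apply: eq_bigr => m _.
  by rewrite (extend0_big _ (F := fun _ k => k`!%:R^-1)).
by move=> m m' _ _; apply: extend0_inj.
Qed.

Definition admissible (m : multiplicities) :=
  ((\sum_u m u == a) && (\sum_u m u * psize (val (val u)) == b))%N.

(** Grouping the admissible multiplicity functions by the partition that they
assemble to. *)
Lemma coeftq_partitions :
  coeftq (sumtq (fun p : npartition n.+1 =>
    ratc (comb_weight p) * vart ^+ corner p * varq ^+ psize p)) a b =
  \sum_(m | admissible m) weight m.
Proof.
pose F (p : npartition n.+1) m :=
  if (assemble m == p) && admissible m then weight m else 0.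
transitivity (\sum_(p \in [set: npartition n.+1]) \sum_m F p m).
  apply: eq_fsbigr => p _; rewrite coeftq_monomial -big_mkcond /=.
  have [/andP[/eqP pa /eqP pb]|pN] := boolP ((a == corner p) && (b == psize p)).
    rewrite mulr1 comb_weightE //; apply: eq_bigl => m.
    case: eqP => //= mp.
    rewrite /admissible -assemble_corner -assemble_psize mp.
    by rewrite -pa -pb !eqxx.
  rewrite mulr0 big1 // => m /andP[/eqP mp].
  rewrite /admissible -assemble_corner -assemble_psize mp.
  by rewrite (eq_sym _ a) (eq_sym _ b) (negPf pN).
pose B := [fset assemble m | m in multiplicities]%fset.
rewrite (fsbigTE B) => [|p pN]; last first.
  rewrite big1 // => m _; rewrite /F; case: eqP => //= mp.
  by case/imfsetP: pN; exists m.
rewrite exchange_big [RHS]big_mkcond; apply: eq_bigr => m _.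
have mB : assemble m \in B by apply/imfsetP; exists m.
rewrite (big_fsetD1 _ mB) /= /F eqxx big_seq big1 ?addr0 // => p.
by rewrite !inE eq_sym => /andP[/negPf ->].
Qed.

(** Replacing [nepartgf n] by its truncation to the partitions of size at most
[b] makes the multinomial theorem applicable, with each [y x] equal to
[q^|x|]. *)
Lemma coefs_nepartgf_exp :
  a`!%:R^-1 * coefs (nepartgf n ^+ a) b = \sum_(m | admissible m) weight m.
Proof.
pose P : {poly rat} := \sum_(u : small_parts) 'X^(psize (val (val u))).
rewrite (@coefs_expr_poly _ _ P b) // => [|d db]; last first.
  rewrite /P coef_sum /= (fsbigTE small_parts) => [|x].
    by rewrite big_seq_fsetE; apply: eq_bigr => u _; rewrite coefXn.
  by rewrite in_small_parts; case: eqP => // <-; rewrite db.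
rewrite -coefZ -[_ *: _]/(divpow a P) divpow_multinomial coef_sum.
rewrite [RHS]big_mkcond [LHS]big_mkcond; apply: eq_bigr => m _.
rewrite /admissible; case: eqP => //= _; rewrite coefZ.
under [X in _ * (polyseq X)`_b]eq_bigr do rewrite -exprM mulnC.
by rewrite prodrXr coefXn eq_sym; case: eqP => _; rewrite ?mulr1 ?mulr0.
Qed.

End MultiplicityFunctions.

Theorem proposition4p14 (n : nat) :
  sumtq (fun p : npartition n.+1 =>
    ratc (comb_weight p) * vart ^+ corner p * varq ^+ psize p)
  = exptq (vart * (partgf n - 1)).
Proof.
apply: fpsP => a; apply: fpsP => b.
rewrite -[LHS]/(coeftq _ a b) -[RHS]/(coeftq _ a b) coeftq_partitions.
by rewrite partgf_sub1 coeftq_exptq coefs_nepartgf_exp.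
Qed.
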